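(* Let $Q\in\mathbb{R}^{n\times n}$ be symmetric positive definite, $q\in\mathbb{R}^n$, $A\in\mathbb{R}^{m\times n}$, $c\in\mathbb{R}^m$, and consider the quadratic program $$\text{minimize } \tfrac12x^\top Qx+q^\top x\quad\text{subject to } Ax\le c$$ and the corresponding ADMM iterations with step-size $\rho>0$ $$x^{k+1}=-(Q+\rho A^\top A)^{-1}[q+\rho A^\top(z^k+u^k-c)],\quad z^{k+1}=\max\{0,-Ax^{k+1}-u^k+c\},\quad u^{k+1}=u^k+Ax^{k+1}-c+z^{k+1}.$$ Let $\lambda_{\min}$ and $\lambda_{\max}$ be the smallest and largest eigenvalues of $AQ^{-1}A^\top$. If the constraint matrix $A$ is either of full row-rank or invertible, then the optimal step-size (the $\rho>0$ minimizing the convergence factor) and the corresponding convergence factor for the $F^{k+1}v^{k+1}-F^kv^k$ residuals are $$\rho^\star=\left(\sqrt{\lambda_{\min}\lambda_{\max}}\right)^{-1},\qquad \zeta^\star=\frac{\lambda_{\max}}{\lambda_{\max}+\sqrt{\lambda_{\min}\lambda_{\max}}} .$$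
   Context: The maximum is componentwise and $\|\cdot\|$ is the Euclidean norm. For $k\ge1$ the iterates satisfy $z^k,u^k\ge0$ and $z^k_iu^k_i=0$ for all $i$. For such $k$ let $v^k=z^k+u^k$, let $D^k$ be the diagonal $m\times m$ matrix with $D^k_{ii}=0$ if $u^k_i=0$ and $D^k_{ii}=1$ if $u_i^k\ne0$, and let $F^k=2D^k-I$; thus $F^kv^k=u^k-z^k$. For given $Q$, $A$ and $\rho$, the convergence factor for the residual $F^{k+1}v^{k+1}-F^kv^k$ is the smallest $\zeta$ such that $\|F^{k+1}v^{k+1}-F^kv^k\|\le\zeta\|F^kv^k-F^{k-1}v^{k-1}\|$ is guaranteed for all $k$, i.e. the supremum of the ratio of consecutive residual norms (nonzero denominator) over all $k$, all initial values $z^0,u^0$ and all vectors $q,c$. *)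

(* Defs.v *)
From HB Require Import structures.
From mathcomp Require Import all_boot all_order all_algebra.
From mathcomp Require Import classical_sets reals constructive_ereal ereal.

Set Implicit Arguments.
Unset Strict Implicit.
Unset Printing Implicit Defensive.

Import Order.TTheory GRing.Theory Num.Theory.
Local Open Scope classical_set_scope.
Local Open Scope ring_scope.

(* The norm [`| x |] that MathComp-Analysis puts on matrices is the sup norm. *)
Definition enorm (R : realType) (m : nat) (x : 'cV[R]_m) : R :=
  Num.sqrt (\sum_(i < m) x i 0 ^+ 2).

Definition sym_posdef (R : realType) (n : nat) (Q : 'M[R]_n) : Prop :=
  Q^T = Q /\ forall x : 'cV[R]_n, x != 0 -> 0 < (x^T *m Q *m x) 0 0.

(* Unlike membership in [unitmx], this makes sense for [A] in ['M_(m, n)]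
   without knowing that [m] and [n] are the same term. *)
Definition mx_invertible (R : realType) (m n : nat) (A : 'M[R]_(m, n)) : Prop :=
  exists B : 'M[R]_(n, m), A *m B = 1%:M /\ B *m A = 1%:M.

Definition smallest_eigenvalue (R : realType) (m : nat) (M : 'M[R]_m) (l : R) :
    Prop :=
  eigenvalue M l /\ forall a : R, eigenvalue M a -> l <= a.

Definition largest_eigenvalue (R : realType) (m : nat) (M : 'M[R]_m) (l : R) :
    Prop :=
  eigenvalue M l /\ forall a : R, eigenvalue M a -> a <= l.

Definition admm_x (R : realType) (m n : nat) (Q : 'M[R]_n) (q : 'cV[R]_n)
    (A : 'M[R]_(m, n)) (c : 'cV[R]_m) (rho : R) (z u : 'cV[R]_m) : 'cV[R]_n :=
  - (invmx (Q + rho *: (A^T *m A)) *m (q + rho *: (A^T *m (z + u - c)))).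

Definition admm_step (R : realType) (m n : nat) (Q : 'M[R]_n) (q : 'cV[R]_n)
    (A : 'M[R]_(m, n)) (c : 'cV[R]_m) (rho : R) (zu : 'cV[R]_m * 'cV[R]_m) :
    'cV[R]_m * 'cV[R]_m :=
  let: (z, u) := zu in
  let x' := admm_x Q q A c rho z u in
  let z' := \col_i Num.max 0 ((- (A *m x') - u + c) i 0) in
  let u' := u + A *m x' - c + z' in
  (z', u').

(* The pair [(z^k, u^k)]; [x^k] for [k >= 1] is determined by
   [(z^(k-1), u^(k-1))], and there is no [x^0]. *)
Definition admm_iter (R : realType) (m n : nat) (Q : 'M[R]_n) (q : 'cV[R]_n)
    (A : 'M[R]_(m, n)) (c : 'cV[R]_m) (rho : R) (z0 u0 : 'cV[R]_m) (k : nat) :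
    'cV[R]_m * 'cV[R]_m :=
  iter k (admm_step Q q A c rho) (z0, u0).

Definition Dmx (R : realType) (m : nat) (u : 'cV[R]_m) : 'M[R]_m :=
  diag_mx (\row_i (if u i 0 == 0 then 0 else 1)).

Definition Fmx (R : realType) (m : nat) (u : 'cV[R]_m) : 'M[R]_m :=
  2 *: Dmx u - 1%:M.

(* [F^k v^k] with [v^k = z^k + u^k]; only meaningful for [k >= 1]. *)
Definition Fv (R : realType) (m n : nat) (Q : 'M[R]_n) (q : 'cV[R]_n)
    (A : 'M[R]_(m, n)) (c : 'cV[R]_m) (rho : R) (z0 u0 : 'cV[R]_m) (k : nat) :
    'cV[R]_m :=
  let: (z, u) := admm_iter Q q A c rho z0 u0 k in Fmx u *m (z + u).

(* [F^(k+1) v^(k+1) - F^k v^k] *)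
Definition residual (R : realType) (m n : nat) (Q : 'M[R]_n) (q : 'cV[R]_n)
    (A : 'M[R]_(m, n)) (c : 'cV[R]_m) (rho : R) (z0 u0 : 'cV[R]_m) (k : nat) :
    'cV[R]_m :=
  Fv Q q A c rho z0 u0 k.+1 - Fv Q q A c rho z0 u0 k.

(* Since [F^k] and [v^k] exist for [k >= 1] only, the earliest residual is
   [residual 1], and the earliest ratio is [residual 2] over [residual 1].
   The supremum is taken in the extended reals, so it always exists. *)
Definition convergence_factor (R : realType) (m n : nat) (Q : 'M[R]_n)
    (A : 'M[R]_(m, n)) (rho : R) : \bar R :=
  ereal_sup [set r : \bar R |
    exists (q : 'cV[R]_n) (c z0 u0 : 'cV[R]_m) (k : nat),
      [/\ (1 <= k)%N,
          residual Q q A c rho z0 u0 k != 0 &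
          r = (enorm (residual Q q A c rho z0 u0 k.+1)
               / enorm (residual Q q A c rho z0 u0 k))%:E]].

Definition optimal_step_size (R : realType) (m n : nat) (Q : 'M[R]_n)
    (A : 'M[R]_(m, n)) (rho : R) : Prop :=
  0 < rho /\
  forall rho' : R, 0 < rho' ->
    (convergence_factor Q A rho <= convergence_factor Q A rho')%E.

(* Main.v *)
(** Put [w^k = F^k v^k = u^k - z^k], so that [v^k = |w^k|] componentwise. With
    [S = A Q^-1 A^T] and [M = rho A (Q + rho A^T A)^-1 A^T = rho S (1 + rho S)^-1]
    the iteration reads [w^(k+1) = w^k / 2 + (1/2 - M) |w^k| + g], where [g] depends
    only on [q] and [c]. Hence the residuals satisfy
    [r^(k+1) = r^k / 2 + (1/2 - M) (|w^(k+1)| - |w^k|)].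

    Lower bound, for every [rho]: [w^1] and [w^2] can be prescribed freely through
    [c], [z^0] and [u^0]. If [w^2 - w^1 = e] is an eigenvector of [S] for [l] and
    [w^1, w^2] are both nonnegative (resp. nonpositive), then [r^2 = (1 - M) e]
    (resp. [r^2 = M e]), so the factor is at least [1 / (1 + rho l)] and
    [rho l / (1 + rho l)]. Using the first for [lmin] and the second for [lmax],
    the two bounds cross exactly at [rho^2 lmin lmax = 1], with value [zeta_star].

    Upper bound, only needed at this [rho]: the triangle inequality reduces it to
    [||(1/2 - M) d|| <= (zeta_star - 1/2) ||d||], which amounts to
    [(S - lmin) (lmax - S) >= 0]. *)

Require Import Defs.
From HB Require Import structures.
From mathcomp Require Import all_boot all_order all_algebra.
From mathcomp Require Import classical_sets reals constructive_ereal ereal.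
From mathcomp Require Import sesquilinear spectral complex ring lra.

Set Implicit Arguments.
Unset Strict Implicit.
Unset Printing Implicit Defensive.

Import Order.TTheory GRing.Theory Num.Theory.
Local Open Scope ring_scope.
Local Open Scope sesquilinear_scope.

(** * Positive definite matrices and spectral bounds *)

Lemma posdef_unitmx (R : realType) (n : nat) (Q : 'M[R]_n) :
  (forall x : 'cV[R]_n, x != 0 -> 0 < (x^T *m Q *m x) 0 0) -> Q \in unitmx.
Proof.
move=> Qpos; rewrite unitmxE unitfE; apply/det0P => -[v v0 vQ].
have := Qpos v^T; rewrite trmxK vQ mul0mx mxE ltxx => H.
suff: false by []. by apply: H; rewrite -(trmx0 R) (inj_eq trmx_inj).
Qed.

(** Row [i] of the diagonalising unitary matrix is a left eigenvector; it is nonzero because that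
    matrix has a right inverse. *)
Lemma eigenvalue_spectral_diag (C : numClosedFieldType) (n : nat)
    (M : 'M[C]_n) (i : 'I_n) :
  M \is normalmx -> eigenvalue M (spectral_diag M 0 i).
Proof.
move=> /orthomx_spectralP eM; apply/eigenvalueP.
exists (row i (spectralmx M)); last first.
  have := spectral_unit M; rewrite -row_free_unit => /row_freeP[B PB].
  apply: contra_eq_neq (congr1 (fun X : 'M_n => row i X) PB) => /eqP rP.
  rewrite row_mul (eqP rP) mul0mx row1; apply/eqP => /rowP/(_ i).
  by rewrite !mxE !eqxx => /esym/eqP; rewrite oner_eq0.
rewrite -row_mul [X in row i (_ *m X)]eM !mulmxA mulmxV ?spectral_unit//.
by rewrite mul1mx mul_diag_mx; apply/rowP => j; rewrite !mxE.
Qed.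

(* The polynomial (X - a)(b - X) is nonnegative on the spectrum of [S]. *)
Lemma spectrum_between (R : realType) (m : nat) (S : 'M[R]_m) (a b : R)
    (x : 'cV[R]_m) :
  S^T = S -> smallest_eigenvalue S a -> largest_eigenvalue S b ->
  0 <= ((S *m x - a *: x)^T *m (b *: x - S *m x)) 0 0.
Proof.
move=> Ssym [_ Sa] [_ Sb].
(* The spectral theorem is applied to the complexification of [S]; its eigenvalues are real, so they
   come from eigenvalues of [S] and lie between [a] and [b]. *)
pose f : {rmorphism R -> R[i]} := real_complex R.
pose SC := map_mx f S.
have freal k : f k \is Num.real by apply/complex_realP; exists k.
have SCh : SC \is hermsymmx.
  apply/realsym_hermsym; last by apply/mxOverP => i j; rewrite mxE freal.
  by apply/is_hermitianmxP; rewrite expr0 scale1r map_mx_id // map_trmx Ssym.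
have SCn := hermitian_normalmx SCh.
have := hermitian_spectral_diag_real SCh.
have := orthomx_spectralP SCn.
have := fun i => eigenvalue_spectral_diag i SCn.
have := spectral_unitarymx SC.
set P := spectralmx SC; set d := spectral_diag SC => /unitarymxP Pun dE SCE dreal.
have dbound i : [&& f a <= d 0 i, d 0 i <= f b & d 0 i \is Num.real].
  have /complex_realP[l dl] := mxOverP dreal 0 i.
  have := dE i; rewrite -/d dl eigenvalue_map => l_eig.
  by apply/and3P; split; [rewrite lecR Sa | rewrite lecR Sb |
    by apply/complex_realP; exists l].
have PinvP : P^t* *m P = 1%:M by exact: (mulmx1C Pun).
have PSC : P *m SC = diag_mx d *m P.
  by rewrite {1}SCE !mulmxA mulmxV ?spectral_unit// mul1mx.
pose y := P *m map_mx f x.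
rewrite -ler0c -[X in 0 <= X]/(f _).
(* In eigenvector coordinates [y] the form is the sum of [(d_i - a) (b - d_i) |y_i|^2]. *)
suff -> : f (((S *m x - a *: x)^T *m (b *: x - S *m x)) 0 0) =
  ((diag_mx d *m y - f a *: y)^t* *m (f b *: y - diag_mx d *m y)) 0 0.
  rewrite !mxE sumr_ge0 // => i _.
  rewrite !mul_diag_mx !mxE -mulrBl rmorphM -mulrBl mulrACA.
  have /and3P[ad db dr] := dbound i.
  rewrite /= (CrealP (rpredB dr (freal a))).
  apply: mulr_ge0; first by rewrite mulr_ge0 ?subr_ge0.
  by rewrite mulrC mul_conjC_ge0.
transitivity (((map_mx f (S *m x - a *: x))^t* *m map_mx f (b *: x - S *m x)) 0 0).
  rewrite map_trmx realmxC; last first.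
    by apply/mxOverP => i j; rewrite mxE freal.
  by rewrite -map_mxM [in RHS]mxE.
have Px (k : R) : P *m map_mx f (S *m x - k *: x) = diag_mx d *m y - f k *: y.
  by rewrite map_mxB map_mxM map_mxZ mulmxBr -scalemxAr mulmxA PSC mulmxA.
(* Flipping a sign on each side gives both factors the shape [S x - k x], to which [Px] applies. *)
rewrite -[X in (_ *m map_mx _ X) 0 0 = _]opprB.
rewrite -[X in _ = (_ *m X) 0 0]opprB.
rewrite map_mxN !mulmxN -!Px trmx_mul map_mxM.
by rewrite mulmxA -[_ *m P]mulmxA PinvP mulmx1.
Qed.

(** * Euclidean norm and inner product *)

Lemma enorm_ge0 (R : realType) (m : nat) (x : 'cV[R]_m) : 0 <= enorm x.
Proof. exact: sqrtr_ge0. Qed.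

Lemma sqr_enorm (R : realType) (m : nat) (x : 'cV[R]_m) :
  enorm x ^+ 2 = (x^T *m x) 0 0.
Proof.
rewrite sqr_sqrtr; last by apply: sumr_ge0 => i _; exact: sqr_ge0.
by rewrite mxE; apply: eq_bigr => i _; rewrite mxE expr2.
Qed.

Lemma enorm_gt0 (R : realType) (m : nat) (x : 'cV[R]_m) :
  x != 0 -> 0 < enorm x.
Proof.
move=> x0; rewrite sqrtr_gt0 lt_def sumr_ge0 => [|i _]; last exact: sqr_ge0.
rewrite andbT; apply: contra x0 => /eqP s0; apply/eqP/colP => i; rewrite mxE.
by apply/eqP; rewrite -sqrf_eq0 (psumr_eq0P _ s0) // => j _; exact: sqr_ge0.
Qed.

Lemma enormZ (R : realType) (m : nat) (a : R) (x : 'cV[R]_m) :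
  0 <= a -> enorm (a *: x) = a * enorm x.
Proof.
move=> a0; rewrite /enorm.
under eq_bigr => i _ do rewrite mxE exprMn.
by rewrite -mulr_sumr sqrtrM ?sqr_ge0 // sqrtr_sqr ger0_norm.
Qed.

Lemma mxDE (V : nmodType) (m n : nat) (x y : 'M[V]_(m, n)) i j :
  (x + y) i j = x i j + y i j.
Proof. exact: mxE. Qed.

Lemma mxNE (V : zmodType) (m n : nat) (x : 'M[V]_(m, n)) i j :
  (- x) i j = - x i j.
Proof. exact: mxE. Qed.

Lemma mxZE (R : pzSemiRingType) (m n : nat) (a : R) (x : 'M[R]_(m, n)) i j :
  (a *: x) i j = a * x i j.
Proof. exact: mxE. Qed.

Lemma dotC (R : comNzRingType) (m : nat) (x y : 'cV[R]_m) :
  (x^T *m y) 0 0 = (y^T *m x) 0 0.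
Proof. by rewrite -[x^T *m y]trmxK trmx_mul trmxK mxE. Qed.

Lemma sqr_enormD (R : realType) (m : nat) (x y : 'cV[R]_m) :
  enorm (x + y) ^+ 2 = enorm x ^+ 2 + 2 * (x^T *m y) 0 0 + enorm y ^+ 2.
Proof.
rewrite !sqr_enorm [(x + y)^T]linearD /= mulmxDl !mulmxDr !mxDE.
by rewrite (dotC y); ring.
Qed.

(** Expand [||b x - y||^2 >= 0] and divide by [b]; when [b = 0] the hypothesis forces [y = 0]. *)
Lemma cauchy_schwarz (R : realType) (m : nat) (x y : 'cV[R]_m) (b : R) :
  0 <= b -> enorm y <= b * enorm x -> (x^T *m y) 0 0 <= b * enorm x ^+ 2.
Proof.
move=> b0 yx; have [b00|bn0] := eqVneq b 0; last first.
  have := sqr_ge0 (enorm (b *: x + - y)).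
  rewrite sqr_enormD enormZ // exprMn.
  have -> : enorm (- y) = enorm y.
    by congr Num.sqrt; apply: eq_bigr => i _; rewrite mxE sqrrN.
  rewrite mulmxN mxNE [(b *: x)^T]linearZ /= -scalemxAl mxZE => H.
  have := ler_pM (enorm_ge0 _) (enorm_ge0 _) yx yx.
  rewrite -!expr2 exprMn => H2.
  have bp : 0 < b by rewrite lt_def bn0.
  rewrite -(ler_pM2l bp) mulrA -expr2; lra.
have -> : y = 0.
  apply/eqP/negPn/negP => /enorm_gt0; rewrite ltNge => /negP; apply.
  by move: yx; rewrite b00 mul0r.
by rewrite b00 mulmx0 mxE mul0r.
Qed.

(** The triangle inequality in the form needed for the residual recursion, obtained by comparing
    squares. *)
Lemma enorm_half_add (R : realType) (m : nat) (x y : 'cV[R]_m) (b : R) :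
  0 <= b -> enorm y <= b * enorm x ->
  enorm (2^-1 *: x + y) <= (2^-1 + b) * enorm x.
Proof.
move=> b0 yx; have xy := cauchy_schwarz b0 yx.
have yy := ler_pM (enorm_ge0 _) (enorm_ge0 _) yx yx.
rewrite -ler_sqr ?nnegrE ?enorm_ge0 ?mulr_ge0 ?enorm_ge0 ?addr_ge0 //.
rewrite sqr_enormD enormZ ?invr_ge0 // [(_ *: x)^T]linearZ /= -scalemxAl mxZE.
move: yy xy; rewrite -!expr2 !exprMn sqrrD; lra.
Qed.

(** * The matrix [M] of the iteration and its relation to [S] *)

Definition admm_mx (R : realType) (m n : nat) (Q : 'M[R]_n) (A : 'M[R]_(m, n))
    (rho : R) : 'M[R]_m :=
  rho *: (A *m invmx (Q + rho *: (A^T *m A)) *m A^T).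

Lemma gram_ge0 (R : realType) (m n : nat) (A : 'M[R]_(m, n)) (x : 'cV[R]_n) :
  0 <= (x^T *m (A^T *m A) *m x) 0 0.
Proof. by rewrite mulmxA -trmx_mul -mulmxA -sqr_enorm sqr_ge0. Qed.

(** Push-through identity: [A^T (1 + rho S) = (Q + rho A^T A) Q^-1 A^T], so the inverse inside [M]
    cancels. *)
Lemma admm_mxM (R : realType) (m n : nat) (Q : 'M[R]_n) (A : 'M[R]_(m, n))
    (rho : R) (S := A *m invmx Q *m A^T) :
  sym_posdef Q -> 0 < rho ->
  admm_mx Q A rho *m (1%:M + rho *: S) = rho *: S.
Proof.
move=> hQ rho0; have Qu : Q \in unitmx by apply: posdef_unitmx; case: hQ.
have Ku : Q + rho *: (A^T *m A) \in unitmx.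
  apply: posdef_unitmx => x x0; rewrite mulmxDr mulmxDl mxDE ltr_pwDl //.
    by case: hQ => _; apply.
  by rewrite -scalemxAr -scalemxAl mxZE mulr_ge0 ?gram_ge0 // ltW.
have AT : A^T *m (1%:M + rho *: S) =
    (Q + rho *: (A^T *m A)) *m (invmx Q *m A^T).
  rewrite mulmxDr mulmx1 mulmxDl mulmxA mulmxV // mul1mx.
  by rewrite -scalemxAr -scalemxAl /S !mulmxA.
rewrite /admm_mx -scalemxAl -[_ *m A^T *m _]mulmxA AT.
by rewrite -[A *m _ *m _]mulmxA mulKmx // mulmxA.
Qed.

(** With [y = Q^-1 A^T x] the form equals [y^T Q y], and full row rank keeps [y] nonzero. *)
Lemma schur_posdef (R : realType) (m n : nat) (Q : 'M[R]_n) (A : 'M[R]_(m, n))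
    (x : 'cV[R]_m) :
  sym_posdef Q -> row_free A -> x != 0 ->
  0 < (x^T *m (A *m invmx Q *m A^T) *m x) 0 0.
Proof.
move=> [Qsym Qpos] Afree x0.
have Qu := posdef_unitmx Qpos.
pose y := invmx Q *m (A^T *m x).
have y0 : y != 0.
  apply: contraNneq x0 => y0.
  have : x^T *m A = 0.
    rewrite -[x^T *m A]trmxK trmx_mul trmxK -[A^T *m x](mulKVmx Qu).
    by rewrite -/y y0 mulmx0 trmx0.
  move/eqP; rewrite mulmx_free_eq0 // => /eqP/(congr1 trmx).
  by rewrite trmxK trmx0 => ->.
have := Qpos y y0; congr (0 < fun_of_matrix _ _ _).
rewrite /y !trmx_mul trmxK trmx_inv Qsym.
by rewrite !mulmxA mulmxKV.
Qed.

Lemma eigenvalue_sym (R : fieldType) (m : nat) (S : 'M[R]_m) (l : R) :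
  S^T = S -> eigenvalue S l -> exists2 e : 'cV[R]_m, e != 0 & S *m e = l *: e.
Proof.
move=> Ssym /eigenvalueP[v vS v0]; exists v^T.
  by rewrite -(trmx0 R) (inj_eq trmx_inj).
by rewrite -{1}Ssym -trmx_mul vS linearZ.
Qed.

Lemma posdef_eigenvalue_gt0 (R : realType) (m : nat) (S : 'M[R]_m) (l : R) :
  S^T = S -> (forall x : 'cV[R]_m, x != 0 -> 0 < (x^T *m S *m x) 0 0) ->
  eigenvalue S l -> 0 < l.
Proof.
move=> Ssym Spos /(eigenvalue_sym Ssym)[e e0 Se].
have := Spos e e0; rewrite -mulmxA Se -scalemxAr mxZE -sqr_enorm.
by rewrite pmulr_lgt0 // exprn_gt0 // enorm_gt0.
Qed.

(** * The iteration in the single variable [w] *)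

(** This is [w^(k+1)] computed from [(z^k, u^k)]: its negative part becomes the new [z], its
    positive part the new [u]. *)
Definition admm_w (R : realType) (m n : nat) (Q : 'M[R]_n) (q : 'cV[R]_n)
    (A : 'M[R]_(m, n)) (c : 'cV[R]_m) (rho : R) (zu : 'cV[R]_m * 'cV[R]_m) :
    'cV[R]_m :=
  A *m admm_x Q q A c rho zu.1 zu.2 + zu.2 - c.

Lemma admm_stepE (R : realType) (m n : nat) (Q : 'M[R]_n) (q : 'cV[R]_n)
    (A : 'M[R]_(m, n)) (c : 'cV[R]_m) (rho : R) (zu : 'cV[R]_m * 'cV[R]_m) :
  admm_step Q q A c rho zu =
    (\col_i Num.max 0 (- admm_w Q q A c rho zu i 0),
     \col_i Num.max 0 (admm_w Q q A c rho zu i 0)).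
Proof.
case: zu => z u; rewrite /admm_step /admm_w /=.
move: (A *m _) => y.
have E : \col_i Num.max 0 ((- y - u + c) i 0) =
         \col_i Num.max 0 (- (y + u - c) i 0).
  by apply/colP => i; rewrite !mxE; congr Num.max; ring.
rewrite E; congr pair; apply/colP => i; rewrite !mxE.
set wi := y i 0 + u i 0 - c i 0.
by case: (ltrP 0 (- wi)); case: (ltrP 0 wi); rewrite /wi; lra.
Qed.

(* [F^k v^k] is the argument of the positive parts defining [z^k] and [u^k]. *)
Lemma FvS (R : realType) (m n : nat) (Q : 'M[R]_n) (q : 'cV[R]_n)
    (A : 'M[R]_(m, n)) (c : 'cV[R]_m) (rho : R) (z0 u0 : 'cV[R]_m) (k : nat) :
  Fv Q q A c rho z0 u0 k.+1 =
  admm_w Q q A c rho (admm_iter Q q A c rho z0 u0 k).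
Proof.
rewrite /Fv /admm_iter iterS admm_stepE -/(admm_iter Q q A c rho z0 u0 k).
move: (admm_w _ _ _ _ _ _) => w.
rewrite /Fmx /Dmx mulmxBl mul1mx -scalemxAl mul_diag_mx.
apply/colP => i; rewrite !mxE.
case: (ltrP 0 (w i 0)) => w0; case: (ltrP 0 (- w i 0)) => w1; case: eqP => w2; lra.
Qed.

Lemma admm_w_affine (R : realType) (m n : nat) (Q : 'M[R]_n) (q : 'cV[R]_n)
    (A : 'M[R]_(m, n)) (c : 'cV[R]_m) (rho : R) (zu : 'cV[R]_m * 'cV[R]_m) :
  admm_w Q q A c rho zu =
    zu.2 - admm_mx Q A rho *m (zu.1 + zu.2) +
    (admm_mx Q A rho *m c - c - A *m invmx (Q + rho *: (A^T *m A)) *m q).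
Proof.
rewrite /admm_w /admm_x; set K := invmx _.
have -> : A *m - (K *m (q + rho *: (A^T *m (zu.1 + zu.2 - c)))) =
    - (A *m K *m q) - admm_mx Q A rho *m (zu.1 + zu.2 - c).
  rewrite mulmxN mulmxA mulmxDr -scalemxAr opprD.
  by rewrite /admm_mx -scalemxAl !mulmxA.
rewrite [_ *m (_ - c)]mulmxBr.
move: (A *m K *m q) (_ *m (zu.1 + zu.2)) (_ *m c) => r s t.
by apply/colP => i; rewrite !mxE; ring.
Qed.

(** After one step [u = (w + |w|) / 2] and [z + u = |w|]. The initial pair need not be
    complementary, hence the index [k.+1]. *)
Lemma Fv_rec (R : realType) (m n : nat) (Q : 'M[R]_n) (q : 'cV[R]_n)
    (A : 'M[R]_(m, n)) (c : 'cV[R]_m) (rho : R) (z0 u0 : 'cV[R]_m) (k : nat)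
    (w := Fv Q q A c rho z0 u0 k.+1) :
  Fv Q q A c rho z0 u0 k.+2 =
    2^-1 *: w + (2^-1 *: 1%:M - admm_mx Q A rho) *m map_mx Num.norm w +
    (admm_mx Q A rho *m c - c - A *m invmx (Q + rho *: (A^T *m A)) *m q).
Proof.
have itE : admm_iter Q q A c rho z0 u0 k.+1 =
    (\col_i Num.max 0 (- w i 0), \col_i Num.max 0 (w i 0)).
  by rewrite /w FvS /admm_iter iterS admm_stepE.
rewrite FvS admm_w_affine itE /=; congr (_ + _); clearbody w; clear itE.
have -> : \col_i Num.max 0 (- w i 0) + \col_i Num.max 0 (w i 0) =
    map_mx Num.norm w.
  by apply/colP => i; rewrite !mxE; case: (ltrP 0 (w i 0)); case: (ltrP 0 (- w i 0)); case: ger0P; lra.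
have -> : \col_i Num.max 0 (w i 0) = 2^-1 *: w + 2^-1 *: map_mx Num.norm w.
  by apply/colP => i; rewrite !mxE; case: (ltrP 0 (w i 0)); case: ger0P; lra.
by rewrite mulmxBl -[(_ *: 1%:M) *m _]scalemxAl mul1mx addrA.
Qed.

Lemma residual_rec (R : realType) (m n : nat) (Q : 'M[R]_n) (q : 'cV[R]_n)
    (A : 'M[R]_(m, n)) (c : 'cV[R]_m) (rho : R) (z0 u0 : 'cV[R]_m) (k : nat) :
  residual Q q A c rho z0 u0 k.+2 =
    2^-1 *: residual Q q A c rho z0 u0 k.+1 +
    (2^-1 *: 1%:M - admm_mx Q A rho) *m
      (map_mx Num.norm (Fv Q q A c rho z0 u0 k.+2) -
       map_mx Num.norm (Fv Q q A c rho z0 u0 k.+1)).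
Proof.
rewrite /residual [X in X - _ = _]Fv_rec [X in _ - X = _]Fv_rec mulmxBr scalerBr.
by rewrite opprD addrACA subrr addr0 opprD addrACA.
Qed.

Lemma enorm_normB (R : realType) (m : nat) (x y : 'cV[R]_m) :
  enorm (map_mx Num.norm x - map_mx Num.norm y) <= enorm (x - y).
Proof.
rewrite ler_sqrt; last by apply: sumr_ge0 => i _; exact: sqr_ge0.
apply: ler_sum => i _; rewrite !mxE.
rewrite -[leLHS]real_normK ?num_real // -[leRHS]real_normK ?num_real //.
by rewrite ler_sqr ?nnegrE // ler_dist_dist.
Qed.

(** * Lower bounds for every step-size *)

(** The constant term [t] is chosen so that the recursion sends [w1] to [w2]. Since
    [(1 - M) (1 + rho S) = 1], the vector [c = - (1 + rho S) t] produces it when [q = 0]. Taking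
    [z0 = - u0] removes [M] from the first step, leaving [w^1 = u0 + t]. *)
Lemma Fv_init (R : realType) (m n : nat) (Q : 'M[R]_n) (A : 'M[R]_(m, n))
    (rho : R) (w1 w2 : 'cV[R]_m) :
  sym_posdef Q -> 0 < rho ->
  exists c z0 u0 : 'cV[R]_m,
    Fv Q 0 A c rho z0 u0 1 = w1 /\ Fv Q 0 A c rho z0 u0 2 = w2.
Proof.
move=> hQ rho0; set S := A *m invmx Q *m A^T.
pose t := w2 - (2^-1 *: w1 + (2^-1 *: 1%:M - admm_mx Q A rho) *m map_mx Num.norm w1).
pose c := - ((1%:M + rho *: S) *m t).
have ct : admm_mx Q A rho *m c - c - A *m invmx (Q + rho *: (A^T *m A)) *m 0 = t.
  rewrite mulmx0 subr0 /c mulmxN mulmxA admm_mxM // opprK mulmxDl mul1mx.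
  by rewrite addrC addrK.
exists c, (- (w1 - t)), (w1 - t).
have F1 : Fv Q 0 A c rho (- (w1 - t)) (w1 - t) 1 = w1.
  by rewrite FvS admm_w_affine /= ct addNr mulmx0 subr0 subrK.
by split=> //; rewrite Fv_rec ct F1 addrC subrK.
Qed.

Lemma admm_mx_eigen (R : realType) (m n : nat) (Q : 'M[R]_n) (A : 'M[R]_(m, n))
    (rho l : R) (e : 'cV[R]_m) :
  sym_posdef Q -> 0 < rho -> 0 < l -> A *m invmx Q *m A^T *m e = l *: e ->
  admm_mx Q A rho *m e = (rho * l / (1 + rho * l)) *: e.
Proof.
move=> hQ rho0 l0 Se; have d0 : 1 + rho * l != 0.
  by rewrite gt_eqF // addr_gt0 // mulr_gt0.
have := admm_mxM A hQ rho0; move: (admm_mx Q A rho) => M.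
move=> /(congr1 (mulmx^~ e)); rewrite /= -mulmxA mulmxDl mul1mx.
rewrite -!scalemxAl Se scalerA -{1}[e]scale1r -scalerDl -scalemxAr => Me.
by apply: (scalerI d0); rewrite Me scalerA [(1 + _) * _]mulrC divfK.
Qed.

Lemma convergence_factor_ge (R : realType) (m n : nat) (Q : 'M[R]_n)
    (A : 'M[R]_(m, n)) (rho t : R) (w1 w2 : 'cV[R]_m) :
  sym_posdef Q -> 0 < rho -> 0 <= t -> w2 - w1 != 0 ->
  2^-1 *: (w2 - w1) + (2^-1 *: 1%:M - admm_mx Q A rho) *m
    (map_mx Num.norm w2 - map_mx Num.norm w1) = t *: (w2 - w1) ->
  (t%:E <= convergence_factor Q A rho)%E.
Proof.
move=> hQ rho0 t0 e0 Et.
have [c [z0 [u0 [F1 F2]]]] := Fv_init A w1 w2 hQ rho0.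
have r1 : residual Q 0 A c rho z0 u0 1 = w2 - w1 by rewrite /residual F1 F2.
apply: ereal_sup_ubound; exists 0, c, z0, u0, 1%N; split=> //; first by rewrite r1.
rewrite residual_rec F1 F2 r1 Et enormZ // mulfK //.
by rewrite gt_eqF // enorm_gt0.
Qed.

Lemma convergence_factor_eigen_ge (R : realType) (m n : nat) (Q : 'M[R]_n)
    (A : 'M[R]_(m, n)) (rho l : R) (e : 'cV[R]_m) :
  sym_posdef Q -> 0 < rho -> 0 < l -> e != 0 ->
  A *m invmx Q *m A^T *m e = l *: e ->
  (((1 + rho * l)^-1)%:E <= convergence_factor Q A rho)%E /\
  ((rho * l / (1 + rho * l))%:E <= convergence_factor Q A rho)%E.
Proof.
move=> hQ rho0 l0 e0 Se; have Me := admm_mx_eigen hQ rho0 l0 Se.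
have d0 : 0 < 1 + rho * l by rewrite addr_gt0 // mulr_gt0.
(* Shifting by [|e|] fixes the signs: [|e|] and [|e| + e] are nonnegative, [- |e|] and [- |e| + e]
   are nonpositive. *)
pose f : 'cV[R]_m := map_mx Num.norm e.
split.
  have Ee : f + e - f = e by rewrite addrC addKr.
  have En : map_mx Num.norm (f + e) - map_mx Num.norm f = e.
    apply/colP => i; rewrite !mxE normr_id ger0_norm ?addKr; last first.
      by have := ler_norm (- e i 0); rewrite normrN; lra.
    lra.
  apply: (@convergence_factor_ge _ _ _ _ _ _ _ f (f + e)) => //;
    rewrite ?Ee ?invr_ge0 ?(ltW d0) //.
  rewrite En mulmxBl -[(_ *: 1%:M) *m _]scalemxAl mul1mx Me.
  rewrite -scalerBl -scalerDl; congr (_ *: _); field; exact: lt0r_neq0.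
have Ee : - f + e - - f = e by rewrite addrC opprK addrA subrr add0r.
have En : map_mx Num.norm (- f + e) - map_mx Num.norm (- f) = - e.
  apply/colP => i; rewrite !mxE normrN normr_id ler0_norm; last first.
    by have := ler_norm (e i 0); lra.
  lra.
apply: (@convergence_factor_ge _ _ _ _ _ _ _ (- f) (- f + e)) => //;
  rewrite ?Ee ?divr_ge0 ?(ltW d0) ?mulr_ge0 ?(ltW rho0) ?(ltW l0) //.
rewrite En mulmxN mulmxBl -[(_ *: 1%:M) *m _]scalemxAl mul1mx Me opprB.
rewrite -scalerBl -scalerDl; congr (_ *: _); field; exact: lt0r_neq0.
Qed.

(** * Upper bound at the balanced step-size *)

(* With [rho ^ 2 * a * b = 1] the claim, evaluated at [d = (1 + rho S) x], is a
   multiple of [((S - a) x, (b - S) x) >= 0]. *)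
Lemma admm_mx_contraction (R : realType) (m n : nat) (Q : 'M[R]_n)
    (A : 'M[R]_(m, n)) (rho a b : R) (d : 'cV[R]_m)
    (S := A *m invmx Q *m A^T) :
  sym_posdef Q -> 0 < rho -> 0 < b -> S^T = S ->
  smallest_eigenvalue S a -> largest_eigenvalue S b ->
  rho ^+ 2 * (a * b) = 1 -> 1 <= rho * b ->
  enorm ((2^-1 *: 1%:M - admm_mx Q A rho) *m d) <=
    (rho * b / (1 + rho * b) - 2^-1) * enorm d.
Proof.
move=> hQ rho0 b0 Ssym Sa Sb rab rb1.
have := admm_mxM A hQ rho0; rewrite -/S; move: (admm_mx Q A rho) => M MS.
have GS : (1%:M - M) *m (1%:M + rho *: S) = 1%:M.
  by rewrite mulmxBl MS mul1mx addrK.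
(* [1 - M] inverts [1 + rho S], so [d = x + rho S x] and [(1/2 - M) d = (x - rho S x) / 2]. *)
pose x := (1%:M - M) *m d.
have dE : d = x + rho *: (S *m x).
  have -> : x + rho *: (S *m x) = (1%:M + rho *: S) *m x.
    by rewrite mulmxDl mul1mx scalemxAl.
  by rewrite mulmxA (mulmx1C GS) mul1mx.
have NdE : (2^-1 *: 1%:M - M) *m d =
    2^-1 *: (x + (- rho) *: (S *m x)).
  have -> : d = (1%:M + rho *: S) *m x by rewrite mulmxA (mulmx1C GS) mul1mx.
  rewrite mulmxA mulmxBl MS -[(_ *: 1%:M) *m _]scalemxAl mul1mx.
  rewrite mulmxBl -scalemxAl mulmxDl mul1mx -!scalemxAl.
  by move: (S *m x) => y; apply/colP => i; rewrite !mxE; field.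
have beta0 : 0 <= rho * b / (1 + rho * b) - 2^-1.
  have -> : rho * b / (1 + rho * b) - 2^-1 = (rho * b - 1) / (2 * (1 + rho * b)).
    by field; rewrite lt0r_neq0 //; lra.
  by rewrite divr_ge0 //; lra.
rewrite -ler_sqr ?nnegrE ?enorm_ge0 ?mulr_ge0 ?enorm_ge0 //.
rewrite NdE enormZ ?invr_ge0 // dE !exprMn !sqr_enormD.
have Zsq (k : R) (y : 'cV[R]_m) : enorm (k *: y) ^+ 2 = k ^+ 2 * enorm y ^+ 2.
  by rewrite !sqr_enorm [(k *: y)^T]linearZ /= -scalemxAl -scalemxAr !mxZE expr2 mulrA.
rewrite !Zsq -!scalemxAr !mxZE.
have := spectrum_between x Ssym Sa Sb.
have -> : ((S *m x - a *: x)^T *m (b *: x - S *m x)) 0 0 =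
   (a + b) * (x^T *m (S *m x)) 0 0 - enorm (S *m x) ^+ 2 - a * b * enorm x ^+ 2.
  move: (S *m x) => y.
  rewrite !sqr_enorm [(y - a *: x)^T]linearB /= [(a *: x)^T]linearZ /= mulmxBl !mulmxBr.
  rewrite -!scalemxAr -!scalemxAl. rewrite !(mxDE, mxNE, mxZE).
  by rewrite (dotC y x); ring.
move: (enorm x ^+ 2) (enorm (S *m x) ^+ 2) ((x^T *m (S *m x)) 0 0) => p h g ineq.
(* Eliminating [a] turns the comparison of squares into a rational identity in [rho] and [b]. *)
have aE : a = (rho ^+ 2 * b)^-1.
  apply: (mulIf (x := rho ^+ 2 * b)); first by rewrite mulf_neq0 ?expf_neq0 ?gt_eqF.
  by rewrite mulVf ?mulf_neq0 ?expf_neq0 ?gt_eqF // -rab; ring.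
have d0 : 0 < 1 + rho * b by lra.
rewrite -subr_ge0.
have -> : (rho * b / (1 + rho * b) - 2^-1) ^+ 2 * (p + 2 * (rho * g) + rho ^+ 2 * h)
    - 2^-1 ^+ 2 * (p + 2 * (- rho * g) + (- rho) ^+ 2 * h) =
  rho ^+ 3 * b * ((a + b) * g - h - a * b * p) / (1 + rho * b) ^+ 2.
  by rewrite aE; field; rewrite !lt0r_neq0.
by rewrite divr_ge0 ?sqr_ge0 // mulr_ge0 // mulr_ge0 ?exprn_ge0 ?ltW.
Qed.

Lemma convergence_factor_le (R : realType) (m n : nat) (Q : 'M[R]_n)
    (A : 'M[R]_(m, n)) (rho t : R) :
  2^-1 <= t ->
  (forall d, enorm ((2^-1 *: 1%:M - admm_mx Q A rho) *m d) <=
    (t - 2^-1) * enorm d) ->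
  (convergence_factor Q A rho <= t%:E)%E.
Proof.
move=> t2 Nd; apply: ge_ereal_sup => _ [q [c [z0 [u0 [[|k] [k1 r0 ->]] //]]]].
rewrite lee_fin ler_pdivrMr ?enorm_gt0 // residual_rec.
rewrite -[t in leRHS](subrKC 2^-1); apply: enorm_half_add; first by rewrite subr_ge0.
by apply: (le_trans (Nd _)); rewrite ler_wpM2l ?subr_ge0 // enorm_normB.
Qed.

(** * Optimality and uniqueness of the step-size *)

Theorem theorem4 (R : realType) (m n : nat) (Q : 'M[R]_n) (A : 'M[R]_(m, n))
    (lmin lmax : R)
    (hQ : sym_posdef Q)
    (hA : row_free A \/ mx_invertible A)
    (hmin : smallest_eigenvalue (A *m invmx Q *m A^T) lmin)
    (hmax : largest_eigenvalue (A *m invmx Q *m A^T) lmax) :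
  let rho_star := (Num.sqrt (lmin * lmax))^-1 in
  let zeta_star := lmax / (lmax + Num.sqrt (lmin * lmax)) in
  (forall rho : R, optimal_step_size Q A rho <-> rho = rho_star) /\
  convergence_factor Q A rho_star = (zeta_star%:E)%E.
Proof.
set S := A *m invmx Q *m A^T in hmin hmax * => rho_star zeta_star.
have Afree : row_free A.
  by case: hA => // -[B [AB _]]; apply/row_freeP; exists B.
have Ssym : S^T = S.
  by rewrite /S !trmx_mul trmxK trmx_inv (proj1 hQ) mulmxA.
have Sgt0 l : eigenvalue S l -> 0 < l.
  by apply: posdef_eigenvalue_gt0 => // x; exact: schur_posdef.
have [emin min_le] := hmin; have [emax max_ge] := hmax.
have a0 := Sgt0 _ emin; have b0 := Sgt0 _ emax.
have ab : lmin <= lmax by exact: min_le.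
set s := Num.sqrt (lmin * lmax) in rho_star zeta_star *.
have s0 : 0 < s by rewrite sqrtr_gt0 mulr_gt0.
have s2 : s ^+ 2 = lmin * lmax by rewrite sqr_sqrtr // mulr_ge0 ?ltW.
have sb : s <= lmax.
  by rewrite -ler_sqr ?nnegrE ?(ltW s0) ?(ltW b0) // s2 expr2 ler_pM2r.
have rs0 : 0 < rho_star by rewrite invr_gt0.
(* Both lower bounds take the value [zeta_star] at [rho_star], because [s^2 = lmin lmax]. *)
have zE1 : zeta_star = rho_star * lmax / (1 + rho_star * lmax).
  by rewrite /zeta_star /rho_star; field; rewrite !lt0r_neq0 // ?addr_gt0.
have zE2 : zeta_star = (1 + rho_star * lmin)^-1.
  have -> : lmin = s ^+ 2 / lmax by rewrite s2 mulfK // lt0r_neq0.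
  by rewrite /zeta_star /rho_star; field; rewrite !lt0r_neq0 // ?addr_gt0.
have lower rho : 0 < rho ->
    (((1 + rho * lmin)^-1)%:E <= convergence_factor Q A rho)%E /\
    ((rho * lmax / (1 + rho * lmax))%:E <= convergence_factor Q A rho)%E.
  move=> rho0; have [e e0 Se] := eigenvalue_sym Ssym emin.
  have [f f0 Sf] := eigenvalue_sym Ssym emax.
  by split; [have [] := convergence_factor_eigen_ge hQ rho0 a0 e0 Se
            |have [] := convergence_factor_eigen_ge hQ rho0 b0 f0 Sf].
(* The [lmin] bound decreases in [rho] and the [lmax] bound increases. *)
have lower1 rho : 0 < rho ->
    ((1 + rho * lmin)^-1 <= zeta_star) = (rho_star <= rho).
  move=> rho0; rewrite zE2 lef_pV2 ?posrE ?addr_gt0 ?mulr_gt0 //.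
  by rewrite lerD2l ler_pM2r.
have lower2 rho : 0 < rho ->
    (rho * lmax / (1 + rho * lmax) <= zeta_star) = (rho <= rho_star).
  move=> rho0; have p1 : 0 < 1 + rho * lmax by rewrite addr_gt0 // mulr_gt0.
  have p2 : 0 < 1 + rho_star * lmax by rewrite addr_gt0 // mulr_gt0.
  rewrite zE1 ler_pdivrMr // [X in _ <= X]mulrAC ler_pdivlMr // -[RHS](ler_pM2r b0).
  by apply/idP/idP; lra.
have cf : convergence_factor Q A rho_star = zeta_star%:E.
  apply/eqP; rewrite eq_le; apply/andP; split; last first.
    by rewrite zE2; case: (lower _ rs0).
  have rb : 1 <= rho_star * lmax by rewrite mulrC ler_pdivlMr // mul1r.
  apply: convergence_factor_le => [|d].
    rewrite zE1 ler_pdivlMr; last by lra.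
    lra.
  rewrite zE1; apply: (@admm_mx_contraction _ _ _ _ _ _ lmin) => //.
  by rewrite -s2 -exprMn mulVf ?expr1n // lt0r_neq0.
split; last exact: cf.
move=> rho; split=> [[rho0 rho_opt]|->].
  (* An optimal [rho] keeps both bounds below or at [zeta_star], which forces [rho_star <= rho] and
     [rho <= rho_star]. *)
  have := rho_opt _ rs0; rewrite cf => cf_le; have [l1 l2] := lower _ rho0.
  apply: le_anti; rewrite -lower1 // -lower2 // -!lee_fin.
  by rewrite (le_trans l1) // (le_trans l2).
split; first exact: rs0.
move=> rho' rho'0; have [l1 l2] := lower _ rho'0; rewrite cf.
(* Up to [rho_star] the [lmin] bound is at least [zeta_star]; beyond it the [lmax] bound is. *)
have [le_rho|lt_rho] := leP rho' rho_star.
  apply: le_trans l1; rewrite lee_fin zE2 lef_pV2 ?posrE ?addr_gt0 ?mulr_gt0 //.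
  by rewrite lerD2l ler_pM2r.
by apply: le_trans l2; rewrite lee_fin ltW // ltNge lower2 // -ltNge.
Qed.
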